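(* Suppose the extended bi-degree sequences $(\mathbf{N}_n,\mathbf{D}_n,\mathbf{C}_n,\mathbf{Q}_n)$ satisfy Assumption A (stated in the context, with the constants $\mu,\gamma$ and events $\Omega_n$ there), and let $\tau$ be the coupling-breaking generation defined in the context. Then, - for any $1\le k\le h\log n$ with $0<h<1/(2\log\mu)$, if $\mu>1$, - for any $1\le k\le n^b$ with $0<b<\min\{1/2,\gamma\}$, if $\mu\le1$, we have $$P(\tau\le k\mid\Omega_n)=\begin{cases}O\left((n/\mu^{2k})^{-1/2}\right),&\mu>1,\\ O\left((n/k^2)^{-1/2}\right),&\mu=1,\\ O\left(n^{-1/2}\right),&\mu<1,\end{cases}$$ as $n\to\infty$.
   Context: **Extended bi-degree sequence.** For each $n$, $(\mathbf{N}_n,\mathbf{D}_n,\mathbf{C}_n,\mathbf{Q}_n)=\{(N_i,D_i,C_i,Q_i):1\le i\le n\}$ is a (random) sequence with $N_i,D_i\in\mathbb{N}=\{0,1,2,\dots\}$, $C_i,Q_i\in\mathbb{R}$, and $L_n:=\sum_{i=1}^nN_i=\sum_{i=1}^nD_i$. Node $i$ has $N_i$ inbound stubs and $D_i$ outbound stubs. **Assumption A.** There exist constants $H,\nu_1,\dots,\nu_5>0$ with $\mu:=\nu_2/\nu_1$, $\lambda:=\nu_3/\nu_1$ and $\rho:=\nu_5\mu/\nu_1<1$, and constants $0<\kappa\le1$ and $0<c,\gamma,\epsilon<1$, such that the events - $\Omega_{n,1}=\{|\sum_{r=1}^nD_r-n\nu_1|\le n^{1-\gamma}\}$, - $\Omega_{n,2}=\{|\sum_{r=1}^nD_rN_r-n\nu_2|\le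 n^{1-\gamma}\}$, - $\Omega_{n,3}=\{|\sum_{r=1}^nD_r^2-n\nu_3|\le n^{1-\gamma}\}$, - $\Omega_{n,4}=\{|\sum_{r=1}^nD_r^{2+\kappa}-n\nu_4|\le n^{1-\gamma}\}$, - $\Omega_{n,5}=\{|\sum_{r=1}^n|C_r|D_r-n\nu_5|\le n^{1-\gamma},\ \max_{1\le r\le n}|C_r|D_r\le c\}$, - $\Omega_{n,6}=\{\sum_{r=1}^n|Q_r|\le Hn\}$ satisfy, with $\Omega_n=\bigcap_{i=1}^6\Omega_{n,i}$, $P(\Omega_n^c)=O(n^{-\epsilon})$ as $n\to\infty$. **Coupled exploration of the graph and the thorny branching tree (TBT).** Condition on the extended bi-degree sequence. Outbound stubs carry labels: label 1 if the stub belongs to a node not yet attached to the graph; label 2 if its node is already in the graph but the stub is not yet paired; label 3 if the stub has already been paired with an inbound stub. Initially all labels are 1. A node is chosen uniformly at random among the $n$ nodes; it is the first node of the graph and (with the same attributes) the root $\emptyset$ of the tree, and its outbound stubs are relabeled 2. Inbound stubs are then processed one at a time in breadth-first order (generation by generation, starting with those of the root). Each inbound stub being processed draws an outbound stub uniformly at random, with replacement, from all $L_n$ outbound stubs, independently of all previous draws. - Whatever the label drawn, the corresponding node of the TBT (when the inbound stub belongs to a node of the tree) receives an offspring whose attributes are those of the node owning the drawn stub: number of offspring equal to that node's in-degree, one outbound stub pointing to the parent and its remaining outbound stubs left unpaired, and that node's weight and personalization value. - If the label is 1, the owning node is attached to the graph by an edge formed with the drawn stub, the drawn stub is relabeled 3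 and the other outbound stubs of its node are relabeled 2. - If the label is 2, the drawn stub is paired in the graph with the inbound stub (creating a cycle, self-loop or multiple edge) and relabeled 3. - If the label is 3, the draw fails in the graph and draws are repeated for the same inbound stub until a stub with label 1 or 2 is obtained; if the stub so obtained has label 1, its owning node is attached to the graph by an edge formed with that stub, that stub is relabeled 3 and the other outbound stubs of its node are relabeled 2, while if it has label 2, it is paired in the graph with the inbound stub (creating a cycle, self-loop or multiple edge) and relabeled 3. Thus in the TBT, conditionally on the bi-degree sequence, the root's attributes are those of a uniformly chosen node, and all other individuals have independent attributes with node $k$'s attributes chosen with probability $D_k/L_n$. Until a stub with label 2 or 3 is drawn, graph and tree coincide. **Definition of $\tau$.** Let $\hat A_k$ be the set of individuals in generation $k$ of the TBT ($\hat A_0=\{\emptyset\}$). $\tau=k$ if and only if the first inbound stub to draw an outbound stub with label 2 or 3 belongs to a node in $\hat A_k$; $\tau=\infty$ if no such draw ever occurs. So $\tau$ is the number of generations of the TBT that can be completed before the first outbound stub with label 2 or 3 is drawn. $k$ may depend on $n$. *)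

(* Defs.v *)
From HB Require Import structures.
From mathcomp Require Import all_boot all_order all_algebra.
From mathcomp Require Import all_classical all_reals all_analysis.

Set Implicit Arguments.
Unset Strict Implicit.
Unset Printing Implicit Defensive.

Import Order.TTheory GRing.Theory Num.Theory.
Import numFieldNormedType.Exports.

Local Open Scope classical_set_scope.
Local Open Scope ring_scope.

(* The outbound stubs of node i are the pairs (i, j) with j < D_i, and its
   inbound stubs are numbered by j < N_i. *)
Definition stub (n : nat) : Type := ('I_n * nat)%type.

(* The labels 1, 2, 3 of outbound stubs, in this order. *)
Inductive label := Unattached | Unpaired | Paired.

Definition is_unattached (l : label) : bool :=
  if l is Unattached then true else false.

(* An inbound stub waiting to be processed. Individuals of the TBT are named by
   their Ulam-Harris words (the root is [::], the offspring of w through its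
   j-th inbound stub is rcons w j). A node that is only in the graph is named
   by the path through which it was discovered. As long as no stub with label
   2 or 3 has been drawn, all pending stubs belong both to the graph and to the
   tree; afterwards a stub may belong to only one of them. *)
Record inbound := Inbound {
  owner : seq nat;
  index_in : nat;
  in_graph : bool;
  in_tree : bool
}.

Record state (n : nat) := State {
  labels : stub n -> label;
  tree : seq (seq nat * 'I_n); (* individuals, with the node they copy *)
  pending : seq inbound        (* breadth-first queue *)
}.

(* A new node in the graph: its outbound stubs get label 2. *)
Definition attach_node n (v : 'I_n) (l : stub n -> label) : stub n -> label :=
  fun y => if y.1 == v then Unpaired else l y.

Definition pair_stub n (x : stub n) (l : stub n -> label) : stub n -> label :=
  fun y => if y == x then Paired else l y.

Definition inbounds (w : seq nat) (m : nat) (g t : bool) : seq inbound :=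
  if g || t then [seq Inbound w j g t | j <- iota 0 m] else [::].

Definition init n (N : 'I_n -> nat) (v : 'I_n) : state n :=
  State (attach_node v (fun=> Unattached)) [:: ([::], v)]
        (inbounds [::] (N v) true true).

(* The head of the queue draws the outbound stub x. If x has label 3 the head
   stays in the queue for the graph only, so that it draws again, while its
   offspring in the tree has already been created. *)
Definition step n (N : 'I_n -> nat) (x : stub n) (s : state n) : state n :=
  if pending s is h :: q then
    let w := rcons (owner h) (index_in h) in
    let new := inbounds w (N x.1) in
    let tree' := if in_tree h then rcons (tree s) (w, x.1) else tree s in
    if in_graph h then
      match labels s x with
      | Unattached =>
          State (pair_stub x (attach_node x.1 (labels s))) tree'
                (q ++ new true (in_tree h))
      | Unpaired =>
          State (pair_stub x (labels s)) tree' (q ++ new false (in_tree h))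
      | Paired =>
          State (labels s) tree'
                (Inbound (owner h) (index_in h) true false
                   :: q ++ new false (in_tree h))
      end
    else State (labels s) tree' (q ++ new false (in_tree h))
  else s.

(* State after t draws. *)
Fixpoint explore n (N : 'I_n -> nat) (v : 'I_n) (u : nat -> stub n) (t : nat)
    : state n :=
  if t is t'.+1 then step N (u t') (explore N v u t') else init N v.

(* The t-th draw (counted from 0) is made, by the inbound stub h, and gives an
   outbound stub with label 2 or 3. *)
Definition bad_draw n (N : 'I_n -> nat) v (u : nat -> stub n) (t : nat)
    (h : inbound) : Prop :=
  ohead (pending (explore N v u t)) = Some h /\
  ~~ is_unattached (labels (explore N v u t) (u t)).

Definition first_bad_draw n (N : 'I_n -> nat) v (u : nat -> stub n) (t : nat)
    (h : inbound) : Prop :=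
  bad_draw N v u t h /\
  (forall t' h', (t' < t)%N -> ~ bad_draw N v u t' h').

Definition generation n (N : 'I_n -> nat) v (u : nat -> stub n) (k : nat)
    : set (seq nat) :=
  [set w | size w = k /\
     exists t, w \in [seq a.1 | a <- tree (explore N v u t)]].

(* The set below has at most one element; the infimum is +oo if it is empty. *)
Definition tau_of (R : realType) n (N : 'I_n -> nat) v (u : nat -> stub n)
    : \bar R :=
  ereal_inf [set k%:R%:E | k in [set k | exists t h,
    first_bad_draw N v u t h /\ generation N v u k (owner h)]].

Definition sigma_seq (R : realType) d (T : measurableType d) n
    (N D : 'I_n -> T -> nat) (C Q : 'I_n -> T -> R) : set (set T) :=
  <<s [set A | exists i : 'I_n,
        (exists m : nat, A = N i @^-1` [set m] \/ A = D i @^-1` [set m]) \/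
        (exists B : set R, measurable B /\
           (A = C i @^-1` B \/ A = Q i @^-1` B))] >>.

Section Degrees.
Variables (n : nat) (T : Type).

Definition stub_count (D : 'I_n -> T -> nat) (w : T) : nat := (\sum_i D i w)%N.

Definition draws_are (u : nat -> T -> stub n) (s : seq (stub n)) : set T :=
  [set w | [seq u t w | t <- iota 0 (size s)] = s].

End Degrees.

(* An extended bi-degree sequence of n nodes, on a probability space that also
   carries the root of the exploration and its draws. Given the extended
   bi-degree sequence, the root is uniform over the n nodes; given the sequence
   and the root, the draws are independent and uniform over the L_n outbound
   stubs. Nothing is assumed on the draws if L_n = 0, where none is made. *)
Record exploration (R : realType) (n : nat) := Exploration {
  disp : measure_display;
  space : measurableType disp;
  prob : probability space R;
  indeg : 'I_n -> space -> nat;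
  outdeg : 'I_n -> space -> nat;
  weight : 'I_n -> space -> R;
  pers : 'I_n -> space -> R;
  root_node : space -> 'I_n;
  draw : nat -> space -> stub n;
  measurable_indeg : forall i, measurable_fun setT (indeg i);
  measurable_outdeg : forall i, measurable_fun setT (outdeg i);
  measurable_weight : forall i, measurable_fun setT (weight i);
  measurable_pers : forall i, measurable_fun setT (pers i);
  measurable_root : forall v, measurable (root_node @^-1` [set v]);
  measurable_draw : forall t x, measurable (draw t @^-1` [set x]);
  sum_indeg : forall w, stub_count indeg w = stub_count outdeg w;
  root_law : forall E v, sigma_seq indeg outdeg weight pers E ->
    prob (E `&` root_node @^-1` [set v]) = ((n%:R^-1)%:E * prob E)%E;
  draw_law : forall E v s, sigma_seq indeg outdeg weight pers E ->
    E `<=` [set w | (0 < stub_count outdeg w)%N] ->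
    prob (E `&` root_node @^-1` [set v] `&` draws_are draw s) =
    (\int[prob]_(w in E `&` root_node @^-1` [set v])
       (\prod_(x <- s)
          ((x.2 < outdeg x.1 w)%N%:R / (stub_count outdeg w)%:R))%:E)%E
}.

Definition tau (R : realType) n (X : exploration R n) (w : space X) : \bar R :=
  tau_of R (fun i => indeg i w) (root_node w) (fun t => draw t w).

Arguments tau {R n} X w.

Definition cond_prob (R : realType) d (T : measurableType d)
    (P : probability T R) (A B : set T) : R :=
  fine (P (A `&` B)) / fine (P B).

Record constants (R : realType) := Constants {
  cH : R; nu1 : R; nu2 : R; nu3 : R; nu4 : R; nu5 : R;
  kappa : R; cc : R; gamma : R; epsilon : R
}.

Section Assumption.
Variables (R : realType) (a : constants R).

Definition mu : R := nu2 a / nu1 a.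
Definition rho : R := nu5 a * mu / nu1 a.

Definition valid_constants : Prop :=
  [/\ 0 < cH a,
      [/\ 0 < nu1 a, 0 < nu2 a, 0 < nu3 a, 0 < nu4 a & 0 < nu5 a],
      rho < 1,
      0 < kappa a <= 1 &
      [/\ 0 < cc a < 1, 0 < gamma a < 1 & 0 < epsilon a < 1]].

Variables (n : nat) (X : exploration R n).

Let close_to (S : space X -> R) (nu : R) : set (space X) :=
  [set w | `|S w - n%:R * nu| <= n%:R `^ (1 - gamma a)].

Definition Omega1 := close_to (fun w => \sum_r (outdeg r w)%:R) (nu1 a).
Definition Omega2 :=
  close_to (fun w => \sum_r (outdeg r w)%:R * (indeg r w)%:R) (nu2 a).
Definition Omega3 := close_to (fun w => \sum_r (outdeg r w)%:R ^+ 2) (nu3 a).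
Definition Omega4 :=
  close_to (fun w => \sum_r (outdeg r w)%:R `^ (2 + kappa a)) (nu4 a).
Definition Omega5 :=
  close_to (fun w => \sum_r `|weight r w| * (outdeg r w)%:R) (nu5 a) `&`
  [set w | \big[Num.max/0]_r (`|weight r w| * (outdeg r w)%:R) <= cc a].
Definition Omega6 : set (space X) :=
  [set w | \sum_r `|pers r w| <= cH a * n%:R].

Definition Omega : set (space X) :=
  Omega1 `&` Omega2 `&` Omega3 `&` Omega4 `&` Omega5 `&` Omega6.

End Assumption.

Arguments Omega {R} a {n} X _.

(* X m has m.+1 nodes: the root requires at least one node. *)
Definition assumptionA (R : realType) (a : constants R)
    (X : forall m, exploration R m.+1) : Prop :=
  valid_constants a /\
  (fun m => fine (prob (X m) (~` Omega a (X m)))) =O_\oo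
    (fun m => m.+1%:R `^ (- epsilon a)).

(* Main.v *)
Require Import Defs.
From mathcomp Require Import all_boot all_order all_algebra.
From mathcomp Require Import all_classical all_reals all_analysis.
From mathcomp Require Import measurable_realfun ring lra.
Import Order.TTheory GRing.Theory Num.Theory.
Import numFieldNormedType.Exports.
Local Open Scope classical_set_scope.
Local Open Scope ring_scope.

Set Implicit Arguments.
Unset Strict Implicit.
Unset Printing Implicit Defensive.

(** Fix the degrees and write L for the number of outbound stubs. As long as
    every drawn stub has label 1, the exploration is a plain breadth-first
    branching process: node i is drawn with probability D_i / L and adds N_i
    inbound stubs to the queue, and a draw is bad exactly when its node has
    been seen before (first_bad_hit). So tau <= k forces a draw made by an
    inbound stub of generation at most k to return a node already seen, and
    only the generations of the queued stubs and the set of nodes seen matter.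

    Cut the exploration after j draws. Either the draws of generations up to k
    are not finished by then, or one of the first j draws returns a node
    already seen. Let B be the expected number of draws that the queued stubs,
    together with their descendants, still make up to generation k. It drops by
    exactly 1 in mean at each draw (mean_backlog_serve), so Markov's inequality
    bounds the first probability by B / (j + 1). For the second, a draw
    collides with probability D(V) / L, where D(V) is the number of outbound
    stubs of the nodes V seen so far, and each draw increases D(V) by
    sum_i D_i^2 / L in mean. Since a draw is independent of the decision
    whether that draw takes place, the expected number of collisions is at most
    j D(V) / L + j B (sum_i D_i^2) / L^2. The cut after j draws is what keeps
    second moments of the tree, hence of the in-degrees, out of this estimate.
    The sum of both bounds is the function risk below; it is a
    supermartingale along the exploration that also pays for collisions
    (collision_risk_step), and backward induction over cylinder events of the
    draws turns this into a bound on probabilities (measure_hit_cylinder).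

    At the root, B averages to (L / n) (1 + m + ... + m^k), with m the mean
    in-degree of a drawn node, which is the exact first moment of the tree. The
    choice j = floor (sqrt n) balances the two bounds and gives
    O (n^(-1/2) (1 + m + ... + m^k)) (cond_prob_tau_le). On Omega, L and the
    sums of D_i N_i and D_i^2 are within n^(1 - gamma) of multiples of n, so m is
    at most mu (1 + O (n^(-gamma))). As k n^(-gamma) stays bounded for the
    generations allowed, m may be replaced by mu at the price of a constant, and
    the geometric sum is O (mu^k), O (k) or O (1) according to the sign of
    mu - 1. Conditioning on Omega amounts to summing over the countably many
    values of the degrees (measure_tau_le). *)

(** * The exploration before the first bad draw *)

Section Queue.
Variables (n : nat) (N : 'I_n -> nat).
Implicit Types (Q : seq nat) (i v : 'I_n) (s : seq (stub n)).

(** A queue holds the generations of its inbound stubs; it is alive when its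
    next draw still counts for tau <= k. *)
Definition alive (k : nat) Q : bool := if Q is g :: _ then (g <= k)%N else false.

(** The head draws an outbound stub of node i, whose inbound stubs join the
    queue one generation further. *)
Definition serve Q i : seq nat :=
  if Q is g :: q then q ++ nseq (N i) g.+1 else [::].

Definition gens v s : seq nat := foldl serve (nseq (N v) 0%N) [seq x.1 | x <- s].

Definition seen v s : seq 'I_n := v :: [seq x.1 | x <- s].

Definition breadth_first Q : bool :=
  if Q is g :: q then pairwise leq Q && all (geq g.+1) q else true.

Lemma gens_rcons v s x : gens v (rcons s x) = serve (gens v s) x.1.
Proof. by rewrite /gens map_rcons foldl_rcons. Qed.

Lemma pairwise_leq_nseq m g : pairwise leq (nseq m g).
Proof. by elim: m => //= m ->; rewrite andbT; apply/allP => x /nseqP[->]. Qed.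

(** All generations in the queue are g or g + 1, in this order, when g is the
    head: the stubs added at the end have generation g + 1. *)
Lemma breadth_first_serve Q i : breadth_first Q -> breadth_first (serve Q i).
Proof.
case: Q => [//|g q] /= /andP[/andP[gq lq] qg].
have pw : pairwise leq (q ++ nseq (N i) g.+1).
  rewrite pairwise_cat lq pairwise_leq_nseq !andbT.
  by apply/allrelP => x y /(allP qg) xg /nseqP[->].
have le : all (geq g.+1) (q ++ nseq (N i) g.+1).
  by rewrite all_cat qg; apply/allP => x /nseqP[->] /=.
have ge : all (leq g) (q ++ nseq (N i) g.+1).
  by rewrite all_cat gq; apply/allP => x /nseqP[->] /=.
case: (q ++ _) pw le ge => [//|g' q'] pw /= /andP[_ le] /andP[gg' _].
rewrite -[_ && pairwise _ _]/(pairwise leq (g' :: q')) pw /=.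
by apply/allP => x /(allP le) /= /leq_trans; apply.
Qed.

Lemma breadth_first_gens v s : breadth_first (gens v s).
Proof.
elim/last_ind: s => [|s x IH]; last by rewrite gens_rcons breadth_first_serve.
rewrite /gens /=; case: (N v) => //= m; rewrite pairwise_leq_nseq andbT.
by apply/andP; split; apply/allP => x /nseqP[->].
Qed.

(** Generations never decrease along the exploration, so a dead queue stays
    dead. *)
Lemma alive_serve k Q i : breadth_first Q -> alive k (serve Q i) -> alive k Q.
Proof.
case: Q => [//|g q] /= /andP[/andP[gq _] _]; case: q gq => [_|g' q] /=.
  by case: (N i) => //= m; exact: ltnW.
by move=> /andP[gg' _]; exact: leq_trans.
Qed.

End Queue.

Section Link.
Variables (n : nat) (N : 'I_n -> nat).
Implicit Types (v : 'I_n) (u : nat -> stub n).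

Definition prefix_draws u t : seq (stub n) := [seq u i | i <- iota 0 t].

(** A collision that counts for tau <= k, in terms of the queue of generations
    and of the nodes seen only; unlike first_bad_draw it does not refer to
    labels. *)
Definition hit (k : nat) v u t : Prop :=
  alive k (gens N v (prefix_draws u t)) /\
  (u t).1 \in seen v (prefix_draws u t).

Lemma prefix_drawsS u t : prefix_draws u t.+1 = rcons (prefix_draws u t) (u t).
Proof. by rewrite /prefix_draws -addn1 iotaD map_cat cats1. Qed.

Lemma alive_earlier k v u t t' : (t <= t')%N ->
  alive k (gens N v (prefix_draws u t')) -> alive k (gens N v (prefix_draws u t)).
Proof.
elim: t' => [|t' IH]; first by rewrite leqn0 => /eqP ->.
rewrite leq_eqVlt => /predU1P[-> //|tt']; rewrite prefix_drawsS gens_rcons.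
by move=> /alive_serve al; apply: IH => //; apply: al; exact: breadth_first_gens.
Qed.

Lemma eq_prefix_draws u u' t : (forall i, (i < t)%N -> u i = u' i) ->
  prefix_draws u t = prefix_draws u' t.
Proof.
by move=> uu'; apply/eq_in_map => i; rewrite mem_iota add0n => /andP[_ /uu'].
Qed.

Lemma eq_explore v u u' t : (forall i, (i < t)%N -> u i = u' i) ->
  explore N v u t = explore N v u' t.
Proof.
elim: t => //= t IH uu'; rewrite IH ?uu' // => i it.
by rewrite uu' // ltnW.
Qed.

Lemma sizes_inbounds (w : seq nat) m t :
  [seq size (owner h) | h <- inbounds w m true t] = nseq m (size w).
Proof.
rewrite /inbounds -map_comp /= -[in RHS](size_iota 0 m).
by elim: (iota _ _) => //= j l ->.
Qed.

Lemma in_graph_inbounds (w : seq nat) m t : all in_graph (inbounds w m true t).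
Proof. by rewrite /inbounds all_map; apply/allP. Qed.

(** Without a bad draw so far, each draw attaches a new node, all of whose
    outbound stubs lose label 1 at once: a stub has label 1 exactly when its node
    has not been seen. Once the queue is empty draws change nothing and the
    labels stop following the nodes drawn, hence the restriction of the last
    claim. *)
Lemma explore_before_bad v u t :
  (forall t' h', (t' < t)%N -> ~ bad_draw N v u t' h') ->
  [/\ [seq size (owner h) | h <- pending (explore N v u t)] =
        gens N v (prefix_draws u t),
      all in_graph (pending (explore N v u t)) &
      pending (explore N v u t) <> [::] -> forall x,
        is_unattached (labels (explore N v u t) x) =
        (x.1 \notin seen v (prefix_draws u t))].
Proof.
elim: t => [_|t IH nobad].
  rewrite /prefix_draws /gens /seen /=; split.
  - exact: sizes_inbounds.
  - exact: in_graph_inbounds.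
  - by move=> _ x; rewrite /attach_node inE; case: eqP.
have [|qE gE lE] := IH _; first by move=> t' h' /ltnW; exact: nobad.
rewrite prefix_drawsS gens_rcons /=; move: (nobad t).
rewrite /bad_draw; set st := explore N v u t in qE gE lE *.
rewrite -qE /step; case pE : (pending st) gE lE qE => [|h q] /=.
  by rewrite pE.
move=> /andP[hg qg] lE _ /(_ h (leqnn _)).
have {}lE := lE ltac:(by []).
rewrite hg; case Hl: (labels st (u t)) => nb; try by case: nb.
split => /=.
- by rewrite map_cat sizes_inbounds size_rcons.
- by rewrite all_cat qg in_graph_inbounds.
- move=> _ x; rewrite /pair_stub /attach_node /seen map_rcons.
  rewrite -rcons_cons mem_rcons inE.
  have [->|xu] := eqVneq x (u t); first by rewrite eqxx.
  by have [|xu1] := eqVneq x.1 (u t).1; rewrite // lE.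
Qed.

Lemma first_bad_hit k v u t h :
  first_bad_draw N v u t h -> (size (owner h) <= k)%N -> hit k v u t.
Proof.
move=> [[hd bad] nobad] hk; have [qE _ lE] := explore_before_bad nobad.
rewrite /hit -qE; case: (pending _) hd lE => [//|h' q] /= [->] /(_ _) lE; split => //.
by move: bad; rewrite lE ?negbK.
Qed.

(** The infimum in tau is at most k only through an actual element at most k,
    because all elements are natural numbers and k < k + 1. *)
Lemma tau_le_first_bad (R : realType) v u k :
  ((tau_of R N v u <= k%:R%:E)%E : Prop) <->
  exists t h, first_bad_draw N v u t h /\
    (size (owner h) <= k)%N /\ generation N v u (size (owner h)) (owner h).
Proof.
split => [|[t [h [fb [hk gh]]]]].
  move=> tk.
  have [|_ [k' [t [h [fb gh]]] <-]] := @ereal_inf_lt _ _ (k.+1%:R%:E) (le_lt_trans tk _).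
    by rewrite lte_fin ltr_nat.
  rewrite lte_fin ltr_nat ltnS => kk; exists t, h.
  by have [sz _] := gh; rewrite sz.
apply: (@le_trans _ _ ((size (owner h))%:R%:E)); last by rewrite lee_fin ler_nat.
by apply: ereal_inf_lbound; exists (size (owner h)) => //; exists t, h.
Qed.

End Link.

(** * A supermartingale bounding the probability of a collision *)

Section Risk.
Variables (R : realType) (n : nat) (N D : 'I_n -> nat) (k : nat).
Implicit Types (Q : seq nat) (V : seq 'I_n) (i : 'I_n).

Definition stubs : nat := (\sum_i D i)%N.
(** The probability that a draw returns an outbound stub of node i. *)
Definition size_bias i : R := (D i)%:R / stubs%:R.
Definition mean_indeg : R := \sum_i size_bias i * (N i)%:R.
Definition mean_outdeg : R := \sum_i size_bias i * (D i)%:R.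
(** Expected number of inbound stubs within j generations of a given one,
    itself included. *)
Definition progeny (j : nat) : R := \sum_(i < j.+1) mean_indeg ^+ i.
(** Expected number of draws of generation at most k still to come. *)
Definition backlog Q : R := \sum_(g <- Q | (g <= k)%N) progeny (k - g).
(** Probability that a draw hits V, as a list to make it additive. *)
Definition exposed V : R := \sum_(i <- V) size_bias i.
(** With j draws left: the first term bounds the probability that the queue
    outlives them, the other two the expected number of collisions, against the
    nodes V and against the nodes discovered on the way. *)
Definition risk (j : nat) Q V : R :=
  Num.min 1 (backlog Q / j.+1%:R) + j%:R * exposed V
  + j%:R * (mean_outdeg / stubs%:R) * backlog Q.

Lemma size_bias_ge0 i : 0 <= size_bias i.
Proof. by rewrite divr_ge0. Qed.

Lemma mean_indeg_ge0 : 0 <= mean_indeg.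
Proof. by apply: sumr_ge0 => i _; rewrite mulr_ge0 ?size_bias_ge0. Qed.

Lemma mean_outdeg_ge0 : 0 <= mean_outdeg.
Proof. by apply: sumr_ge0 => i _; rewrite mulr_ge0 ?size_bias_ge0. Qed.

Lemma progeny_ge1 j : 1 <= progeny j.
Proof.
rewrite /progeny big_ord_recl expr0 lerDl.
by apply: sumr_ge0 => i _; rewrite exprn_ge0 ?mean_indeg_ge0.
Qed.

Lemma progenyS j : progeny j.+1 = 1 + mean_indeg * progeny j.
Proof.
rewrite /progeny big_ord_recl expr0 mulr_sumr; congr (_ + _).
by apply: eq_bigr => i _; rewrite exprS.
Qed.

Lemma backlog_ge0 Q : 0 <= backlog Q.
Proof. by apply: sumr_ge0 => g _; exact: le_trans (progeny_ge1 _). Qed.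

Lemma exposed_ge0 V : 0 <= exposed V.
Proof. by apply: sumr_ge0 => i _; exact: size_bias_ge0. Qed.

Lemma risk_ge0 j Q V : 0 <= risk j Q V.
Proof.
rewrite /risk !addr_ge0 // ?mulr_ge0 ?invr_ge0 ?mean_outdeg_ge0 ?backlog_ge0 ?exposed_ge0 //.
by rewrite le_min ler01 divr_ge0 ?backlog_ge0.
Qed.

Lemma backlog_nseq m g : (g <= k)%N -> backlog (nseq m g) = m%:R * progeny (k - g).
Proof.
move=> gk; rewrite /backlog; elim: m => [|m IH]; first by rewrite big_nil mul0r.
by rewrite big_cons gk IH -add1n natrD mulrDl mul1r.
Qed.

(** A live stub counts at least itself in the backlog, so the bound starts at
    the trivial value when no draw is left. *)
Lemma risk0 Q V : alive k Q -> risk 0 Q V = 1.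
Proof.
case: Q => //= g q gk; rewrite /risk !mul0r !addr0 divr1 min_l //.
by rewrite /backlog big_cons gk (le_trans (progeny_ge1 (k - g))) // lerDl backlog_ge0.
Qed.

Hypothesis stubs_gt0 : (0 < stubs)%N.

Lemma sum_size_bias : \sum_i size_bias i = 1.
Proof. by rewrite -mulr_suml -natr_sum divff // pnatr_eq0 -lt0n. Qed.

Lemma mean_size_bias (c : R) : \sum_i size_bias i * c = c.
Proof. by rewrite -mulr_suml sum_size_bias mul1r. Qed.

(** The served stub leaves the backlog, and its offspring bring back all it
    stood for except itself. *)
Lemma mean_backlog_serve Q : alive k Q ->
  \sum_i size_bias i * backlog (serve N Q i) = backlog Q - 1.
Proof.
case: Q => //= g q gk; rewrite [backlog (g :: q)]/backlog big_cons gk -/(backlog q).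
under eq_bigr do rewrite /backlog big_cat -/(backlog q) -/(backlog (nseq _ _)) mulrDr.
rewrite big_split /= mean_size_bias.
suff -> : \sum_i size_bias i * backlog (nseq (N i) g.+1) = progeny (k - g) - 1 by ring.
move: gk; rewrite leq_eqVlt => /predU1P[->|gk].
  rewrite subnn [progeny 0]/progeny big_ord1 expr0 subrr big1 // => i _.
  rewrite /backlog big1_seq ?mulr0 // => x /andP[xk /nseqP[xE _]].
  by rewrite xE ltnn in xk.
rewrite -(subnSK gk) progenyS addrC addKr /mean_indeg mulr_suml.
by apply: eq_bigr => i _; rewrite backlog_nseq // mulrA.
Qed.

Lemma mean_min1 (x : 'I_n -> R) :
  \sum_i size_bias i * Num.min 1 (x i) <= Num.min 1 (\sum_i size_bias i * x i).
Proof.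
rewrite le_min; apply/andP; split.
  rewrite -[leRHS]sum_size_bias; apply: ler_sum => i _.
  by rewrite ler_piMr ?size_bias_ge0 // ge_min lexx.
by apply: ler_sum => i _; rewrite ler_wpM2l ?size_bias_ge0 // ge_min lexx orbT.
Qed.

Lemma exposed_rcons i V : exposed (rcons V i) = size_bias i + exposed V.
Proof. by rewrite /exposed -cats1 big_cat big_seq1 addrC. Qed.

(** The Markov bound x / (j + 1) becomes x / (j + 2) with one more draw, since
    the backlog x has decreased by 1; this needs x <= j + 2, and otherwise the
    minimum is 1. *)
Lemma min1_step (x : R) j : 0 <= x ->
  Num.min 1 ((x - 1) / j.+1%:R) <= Num.min 1 (x / j.+2%:R).
Proof.
move=> x0; rewrite le_min ge_min lexx /=.
have [xj|xj] := leP x j.+2%:R.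
  rewrite ge_min; apply/orP; right.
  rewrite ler_pdivrMr // mulrAC ler_pdivlMr //.
  move: xj; rewrite -[j.+2]addn1 -[j.+1]addn1 !natrD; nra.
by rewrite ge_min; apply/orP; left; rewrite ler_pdivlMr // mul1r ltW.
Qed.

(** A new node adds sum_i (D_i / L)^2 to the mean exposure of each of the j
    remaining draws, which the last term of the risk pays for: its backlog has
    decreased by 1. *)
Lemma risk_step j Q V : alive k Q ->
  exposed V + \sum_i size_bias i * risk j (serve N Q i) (rcons V i)
  <= risk j.+1 Q V.
Proof.
move=> Qk; rewrite /risk.
under eq_bigr do rewrite 2!mulrDr.
rewrite 2!big_split /=.
have mB : \sum_i size_bias i * (backlog (serve N Q i) / j.+1%:R) = (backlog Q - 1) / j.+1%:R.
  by rewrite -(mean_backlog_serve Qk) mulr_suml; apply: eq_bigr => i _; rewrite mulrA.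
have survive := mean_min1 (fun i => backlog (serve N Q i) / j.+1%:R).
rewrite mB in survive; have {}survive := le_trans survive (min1_step j (backlog_ge0 Q)).
have -> : \sum_i size_bias i * (j%:R * exposed (rcons V i)) =
          j%:R * (mean_outdeg / stubs%:R) + j%:R * exposed V.
  under eq_bigr do rewrite exposed_rcons !mulrDr.
  rewrite big_split /= mean_size_bias; congr (_ + _).
  rewrite /mean_outdeg mulr_suml mulr_sumr; apply: eq_bigr => i _.
  by rewrite /size_bias; ring.
set c := j%:R * (mean_outdeg / stubs%:R).
have -> : \sum_i size_bias i * (c * backlog (serve N Q i)) = c * (backlog Q - 1).
  rewrite -mean_backlog_serve // mulr_sumr.
  by apply: eq_bigr => i _; rewrite mulrCA.
have c0 : 0 <= mean_outdeg / stubs%:R * backlog Q.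
  by rewrite mulr_ge0 ?backlog_ge0 // divr_ge0 ?mean_outdeg_ge0.
have -> : j.+1%:R * (mean_outdeg / stubs%:R) * backlog Q =
          c * backlog Q + mean_outdeg / stubs%:R * backlog Q.
  by rewrite -addn1 natrD /c; ring.
have -> : j.+1%:R * exposed V = j%:R * exposed V + exposed V.
  by rewrite -addn1 natrD; ring.
lra.
Qed.

(** The recursion that the probability of a collision satisfies: a draw that
    hits V loses at once. *)
Lemma collision_risk_step j Q V : alive k Q ->
  \sum_i size_bias i *
    (if i \in V then 1 else risk j (serve N Q i) (rcons V i))
  <= risk j.+1 Q V.
Proof.
move=> Qk; apply: le_trans (risk_step j V Qk).
apply: (@le_trans _ _ (\sum_(i | i \in V) size_bias i +
    \sum_i size_bias i * risk j (serve N Q i) (rcons V i))).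
  rewrite [X in _ <= X + _]big_mkcond -big_split /=; apply: ler_sum => i _.
  have sb := size_bias_ge0 i; have rk := risk_ge0 j (serve N Q i) (rcons V i).
  by case: ifP => _; rewrite ?mulr1 ?add0r // lerDl mulr_ge0.
rewrite lerD2r /exposed.
elim: V => [|v V IH]; first by rewrite big_nil big_pred0.
rewrite big_cons; apply: le_trans (lerD (lexx _) IH).
rewrite (bigD1 v) ?mem_head //= lerD2l.
rewrite [leLHS]big_mkcond [leRHS]big_mkcond; apply: ler_sum => i _.
rewrite inE; case: (i == v) => //=; rewrite ?andbF ?andbT //.
by case: ifP => // _; exact: size_bias_ge0.
Qed.

(** Averaging over a uniform root, with the Markov bound taken without its
    minimum, leaves only the sums of the degrees. *)
Lemma mean_risk_root j : (0 < n)%N ->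
  \sum_v n%:R^-1 * risk j (nseq (N v) 0%N) [:: v]
  <= (\sum_i (N i)%:R) / n%:R * progeny k
       * (j.+1%:R^-1 + j%:R * (mean_outdeg / stubs%:R)) + j%:R / n%:R.
Proof.
move=> n0.
apply: (@le_trans _ _ (\sum_v (n%:R^-1 * (((N v)%:R * progeny k)
       * (j.+1%:R^-1 + j%:R * (mean_outdeg / stubs%:R))) + n%:R^-1 * (j%:R * size_bias v)))).
  apply: ler_sum => v _; rewrite -mulrDr ler_wpM2l // /risk backlog_nseq // subn0.
  rewrite /exposed big_seq1 mulrDr addrAC lerD2r [_ * (j%:R * _)]mulrC lerD2r.
  by rewrite ge_min lexx orbT.
rewrite big_split /= -!mulr_sumr sum_size_bias mulr1 [j%:R / _]mulrC lerD2r.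
by rewrite -!mulr_suml !mulrA [n%:R^-1 * _]mulrC.
Qed.

End Risk.

(** * Events determined by countably many values *)

Section CountableValued.
Context d (T : measurableType d).

Lemma measurable_preimage_countable (C : countType) (f : T -> C) (B : set C) :
  (forall c, measurable (f @^-1` [set c])) -> measurable (f @^-1` B).
Proof.
move=> mf.
have -> : f @^-1` B = \bigcup_(m in setT)
    (if unpickle m is Some c then if `[< B c >] then f @^-1` [set c] else set0 else set0).
  apply/seteqP; split => [w Bw|w [m _]].
    by exists (pickle (f w)) => //; rewrite pickleK asboolT.
  by case: (unpickle m) => // c; case: asboolP => // Bc fwc; rewrite /preimage /= fwc.
apply: bigcupT_measurable => m.
by case: (unpickle m) => [c|//]; case: asboolP.
Qed.

Lemma measurable_fiber_ffun (I : finType) (C : countType) (f : I -> T -> C) c :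
  (forall i x, measurable (f i @^-1` [set x])) ->
  measurable ((fun w => [ffun i => f i w]) @^-1` [set c]).
Proof.
move=> mf.
have -> : (fun w => [ffun i => f i w]) @^-1` [set c] =
          \bigcap_(i in setT) (f i @^-1` [set c i]).
  apply/seteqP; split => [w <- i _|w cw]; first by rewrite ffunE.
  by apply/ffunP => i; rewrite ffunE cw.
by apply: fin_bigcap_measurable => // i _; exact: mf.
Qed.

Variables (R : realType) (P : probability T R).

(** An inequality between measures may be checked on each fiber of a map with
    countably many values. This is how conditioning on the degrees is undone, and
    with c = 0 it is countable subadditivity for null sets. *)
Lemma le_measure_fibers (C : countType) (f : T -> C) (A B : set T) (c : R) : 0 <= c ->
  (forall x, measurable (f @^-1` [set x])) -> measurable A -> measurable B ->
  (forall x, P (A `&` f @^-1` [set x]) <= c%:E * P (B `&` f @^-1` [set x]))%E ->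
  (P A <= c%:E * P B)%E.
Proof.
move=> c0 mf mA mB AB.
pose F (S : set T) m := S `&` ((pickle \o f) @^-1` [set m]).
have FU S : S = \bigcup_m F S m.
  by apply/seteqP; split => [w Sw|w [m _ []//]]; exists (pickle (f w)).
have mF S m : measurable S -> measurable (F S m).
  move=> mS; apply: measurableI => //; rewrite comp_preimage.
  exact: measurable_preimage_countable.
have tF S : trivIset setT (F S) by move=> i j _ _ [w [[_ <-] [_ <-]]].
have PE S : measurable S -> P S = (\sum_(m <oo) P (F S m))%E.
  move=> mS; rewrite {1}(FU S) measure_semi_bigcup //; first by move=> i; exact: mF.
  by rewrite -FU.
rewrite (PE A) // (PE B) // -nneseriesZl; last by move=> i _; exact: measure_ge0.
apply: lee_nneseries => [m _ _|m _]; first exact: measure_ge0.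
have [[w wm]|no] := pselect (exists w, pickle (f w) = m).
  have FE S : F S m = S `&` f @^-1` [set f w].
    rewrite /F comp_preimage -wm; congr (_ `&` _ @^-1` _).
    apply/seteqP; split => [x /= /(pcan_inj pickleK)//|x -> //].
  by rewrite !FE.
suff FE S : F S m = set0 by rewrite !FE !measure0 mule0.
by rewrite -subset0 => w [_ wm]; apply: no; exists w.
Qed.

Lemma measure_finU (I : finType) (A : set T) (F : I -> set T) :
  measurable A -> (forall i, measurable (F i)) ->
  (forall w, A w -> exists i, F i w) -> (P A <= \sum_i P (F i))%E.
Proof.
move=> mA mF AF.
have [mU leU] : measurable (\big[setU/set0]_i F i) /\
    (P (\big[setU/set0]_i F i) <= \sum_i P (F i))%E.
  elim/big_rec2: _ => [|i y B _ [mB le]]; first by rewrite measure0.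
  split; first exact: measurableU.
  by apply: le_trans (measureU2 _ _ _) _ => //; exact: leeD2l.
apply: le_trans leU; rewrite le_measure ?inE // => w /AF[i Fiw].
by rewrite (bigD1 i) //; left.
Qed.

End CountableValued.

Section Law.
Variables (R : realType) (n : nat) (X : exploration R n).
Local Notation P := (prob X).
Let node_draw := ('I_n * nat)%type.

(** In-degrees, root and finitely many draws take countably many values, so any
    property of them is an event. *)
Lemma measurable_finitary t
    (Psi : ('I_n -> nat) -> 'I_n -> (nat -> stub n) -> Prop) :
  (forall N v u u', (forall i, (i < t)%N -> u i = u' i) ->
    Psi N v u -> Psi N v u') ->
  measurable [set w : Defs.space X |
    Psi (fun i => indeg i w) (root_node w) (fun t => draw t w)].
Proof.
move=> Psi_ext.
pose f (w : Defs.space X) : {ffun 'I_n -> nat} * 'I_n * {ffun 'I_t -> node_draw} :=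
  ([ffun i => indeg i w], root_node w, [ffun i : 'I_t => draw i w]).
set A := [set w | _].
have -> : A = f @^-1` (f @` A).
  apply/seteqP; split => [w Aw|w [w' Aw' [/ffunP Nw vw /ffunP uw]]]; first by exists w.
  rewrite /A /=; have -> : (fun i => indeg i w) = (fun i => indeg i w').
    by apply/funext => i; have := Nw i; rewrite !ffunE.
  rewrite -vw; apply: Psi_ext Aw' => i it.
  by have := uw (Ordinal it); rewrite !ffunE.
apply: measurable_preimage_countable => -[[c v] x].
have -> : f @^-1` [set (c, v, x)] =
    (fun w => [ffun i => indeg i w]) @^-1` [set c] `&` (root_node (e := X)) @^-1` [set v]
    `&` (fun w => [ffun i : 'I_t => draw i w : node_draw]) @^-1` [set x].
  apply/seteqP; split => [w [<- <- <-]//|w [[/= cE vE] xE]].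
  by rewrite /f /= cE vE xE.
apply: measurableI; first apply: measurableI.
- apply: measurable_fiber_ffun => i m.
  by rewrite -[_ @^-1` _]setTI; apply: measurable_indeg.
- exact: measurable_root.
- by apply: measurable_fiber_ffun => i y; exact: measurable_draw.
Qed.

Lemma measurable_draws s : measurable (draws_are (draw (e := X)) s).
Proof.
apply: (@measurable_finitary (size s) (fun _ _ u => prefix_draws u (size s) = s)).
by move=> _ _ u u' uu' sE; rewrite -[RHS]sE; apply/esym; exact: eq_prefix_draws.
Qed.

Lemma measurable_tau_le k : measurable [set w | (tau X w <= k%:R%:E)%E].
Proof.
pose Psi t t' N v (u : nat -> stub n) := exists h, first_bad_draw N v u t h /\
    (size (owner h) <= k)%N /\
    owner h \in [seq a.1 | a <- tree (explore N v u t')].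
have -> : [set w | (tau X w <= k%:R%:E)%E] = \bigcup_t \bigcup_t'
    [set w : Defs.space X | Psi t t' (fun i => indeg i w) (root_node w) (fun t => draw t w)].
  apply/seteqP; split => w.
    move=> /tau_le_first_bad[t [h [fb [hk [_ [t' ht']]]]]].
    by exists t => //; exists t' => //; exists h.
  move=> [t _ [t' _ [h [fb [hk ht']]]]]; apply/tau_le_first_bad; exists t, h.
  by split => //; split => //; split => //; exists t'.
apply: bigcupT_measurable => t; apply: bigcupT_measurable => t'.
apply: (@measurable_finitary (maxn t.+1 t')) => N v u u' uu' [h [[bad nobad] rest]].
have E i : (i <= maxn t.+1 t')%N -> explore N v u i = explore N v u' i.
  by move=> im; apply: eq_explore => l li; apply: uu'; exact: leq_trans li im.
have tm : (t < maxn t.+1 t')%N by rewrite leq_max leqnn.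
have B i h' : (i < maxn t.+1 t')%N -> bad_draw N v u i h' <-> bad_draw N v u' i h'.
  by move=> im; rewrite /bad_draw E ?uu' // ltnW.
exists h; rewrite -E ?leq_maxr //; split => //; split; first by apply/B.
by move=> i h' it; rewrite -B ?(ltn_trans it) //; exact: nobad.
Qed.

Definition hit_after (N : 'I_n -> nat) k v m : set (Defs.space X) :=
  [set w | exists t, (m <= t)%N /\ hit N k v (fun t => draw t w) t].

Lemma measurable_hit_after N k v m : measurable (hit_after N k v m).
Proof.
rewrite (_ : hit_after _ _ _ _ = \bigcup_t
    [set w | (m <= t)%N /\ hit N k v (fun t => draw t w) t]); last first.
  by apply/seteqP; split => [w [t ?]|w [t _ ?]]; exists t.
apply: bigcupT_measurable => t.
apply: (@measurable_finitary t.+1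
  (fun _ _ u => (m <= t)%N /\ hit N k v u t)) => _ _ u u' uu'.
rewrite /hit -(uu' t) // -(@eq_prefix_draws _ u u') // => i it.
by apply: uu'; exact: ltnW.
Qed.

End Law.

(** * Backward induction over the draws *)

Local Notation sigma_degrees X := (sigma_seq (indeg (e := X)) (outdeg (e := X))
  (weight (e := X)) (pers (e := X))).

Lemma sub_sigma_seq_measurable (R : realType) n (X : exploration R n) E :
  sigma_degrees X E -> measurable E.
Proof.
apply; split; first exact: sigma_algebra_measurable.
move=> A [i [[m [->|->]]|[B [mB [->|->]]]]]; rewrite -[X in measurable X]setTI.
- exact: measurable_indeg.
- exact: measurable_outdeg.
- exact: measurable_weight.
- exact: measurable_pers.
Qed.

Section FixedDegrees.
Variables (R : realType) (n : nat) (X : exploration R n) (N D : 'I_n -> nat).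
Variables (E : set (Defs.space X)) (k : nat).
Local Notation P := (prob X).
Hypothesis sigma_E : sigma_degrees X E.
Hypothesis indeg_E : forall w, E w -> forall i, indeg i w = N i.
Hypothesis outdeg_E : forall w, E w -> forall i, outdeg i w = D i.
Hypothesis stubs_gt0 : (0 < stubs D)%N.

Let measurable_E := sub_sigma_seq_measurable sigma_E.

Section FixedRoot.
Variable v : 'I_n.
Let W := E `&` (root_node (e := X)) @^-1` [set v].
Let cylinder s := W `&` draws_are (draw (e := X)) s.

Let measurable_cylinder s : measurable (cylinder s).
Proof.
by apply: measurableI; [apply: measurableI|exact: measurable_draws]; last exact: measurable_root.
Qed.

Lemma measure_cylinder s : P (cylinder s) =
  ((\prod_(x <- s) ((x.2 < D x.1)%N%:R / (stubs D)%:R))%:E * P W)%E.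
Proof.
have mW : measurable W by apply: measurableI => //; exact: measurable_root.
rewrite /cylinder (draw_law _ _ sigma_E); last first.
  move=> w Ew; rewrite /= /stub_count.
  by under eq_bigr do rewrite (outdeg_E Ew).
rewrite -integral_cst //; apply: eq_integral => w; rewrite inE => -[Ew _].
rewrite /cst /stub_count; congr (_%:E); apply: eq_bigr => x _.
by rewrite (outdeg_E Ew); under eq_bigr do rewrite (outdeg_E Ew).
Qed.

Lemma cylinder_rcons s x :
  cylinder (rcons s x) = cylinder s `&` (draw (size s)) @^-1` [set x].
Proof.
rewrite /cylinder -setIA; congr (_ `&` _); rewrite /draws_are size_rcons.
have pE (w : Defs.space X) := prefix_drawsS (fun t => draw t w) (size s).
rewrite /prefix_draws in pE; apply/seteqP; split => [w wE|w [ws wx]].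
  by have [sE xE] := rcons_inj (etrans (esym wE) (pE w)); split; exact: esym.
exact: etrans (pE w) (congr2 rcons ws wx).
Qed.

Lemma measure_cylinder_rcons s x : P (cylinder (rcons s x)) =
  (((x.2 < D x.1)%N%:R / (stubs D)%:R)%:E * P (cylinder s))%E.
Proof.
by rewrite !measure_cylinder -cats1 big_cat /= big_seq1 mulrC EFinM -muleA.
Qed.

(** Draws of pairs that are not outbound stubs form a null event, and the D_i
    outbound stubs of node i are equally likely. *)
Lemma measure_next_node s i :
  (P (cylinder s `&` [set w | (draw (size s) w).1 = i])
   <= (size_bias R D i)%:E * P (cylinder s))%E.
Proof.
set A := cylinder s `&` _.
have mdraw (B : set (stub n)) : measurable (draw (e := X) (size s) @^-1` B).
  apply: (@measurable_preimage_countable _ _ ('I_n * nat)%type) => x.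
  exact: measurable_draw.
have mA : measurable A by apply: measurableI => //; exact: (mdraw [set x | x.1 = i]).
set B := A `&` [set w | (draw (size s) w).2 < D i]%N.
have mB : measurable B by apply: measurableI => //; exact: (mdraw [set x | x.2 < D i]%N).
have -> : P A = P B.
  have mAB : measurable (A `\` B) by exact: measurableD.
  suff D0 : P (A `\` B) = 0%E.
    have : P A = (P (A `\` B) + P (A `&` B))%E by exact: measureDI.
    by rewrite D0 add0e {2}/B setIA setIid.
  apply/eqP; rewrite eq_le measure_ge0 andbT.
  rewrite -(mul0e (P A)).
  apply: (@le_measure_fibers _ _ R P ('I_n * nat)%type (draw (size s)) _ _ 0 (lexx 0)
    (measurable_draw X (size s)) mAB mA) => x; rewrite mul0e.
  have [xi|xi] := pselect (x.1 = i /\ ~~ (x.2 < D i)%N); last first.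
    rewrite le_eqVlt; apply/predU1P; left; apply: etrans (congr1 P _) (measure0 P).
    rewrite -subset0 => w [[Aw Bw] wx].
    apply: xi; case: (Aw) => _ /= <-; rewrite -wx; split => //.
    by apply/negP => lt; apply: Bw; split => //=; case: Aw => _ /= <-.
  have /(le_trans _) : (P (cylinder (rcons s x)) <= 0)%E.
    by rewrite measure_cylinder_rcons; case: xi => -> /negbTE ->; rewrite mul0r mul0e.
  apply; rewrite le_measure ?inE //.
  - by apply: measurableI; [exact: mAB|exact: measurable_draw].
  - by rewrite cylinder_rcons => w [[[cw _] _] wx].
apply: (@le_trans _ _ (\sum_(j < D i) P (cylinder (rcons s (i, val j))))%E).
  apply: measure_finU => // [w [[cw wi] /= lt]].
  exists (Ordinal lt); rewrite cylinder_rcons; split => //=.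
  by rewrite /preimage /= -wi -surjective_pairing.
under eq_bigr => j _ do rewrite measure_cylinder_rcons /= ltn_ord.
rewrite -ge0_sume_distrl => [|j _]; last by rewrite lee_fin divr_ge0.
rewrite sumEFin sumr_const card_ord /size_bias.
by rewrite mul1r -[X in X%:E]mulr_natl.
Qed.

(** Backward induction, one draw at a time: given the first draws s, a collision
    still to come happens either at the next draw or after it. *)
Lemma measure_hit_cylinder j s :
  (P (cylinder s `&` hit_after N k v (size s))
   <= (risk R N D k j (gens N v s) (seen v s))%:E * P (cylinder s))%E.
Proof.
pose H (s : seq (stub n)) := hit_after (X := X) N k v (size s).
have mH s' : measurable (H s') by exact: measurable_hit_after.
rewrite -/(H s).
(* Once dead the queue stays dead, and no later collision counts. *)
have dead j' s' : ~~ alive k (gens N v s') -> (P (cylinder s' `&` H s')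
    <= (risk R N D k j' (gens N v s') (seen v s'))%:E * P (cylinder s'))%E.
  move=> dead; suff -> : cylinder s' `&` H s' = set0.
    by rewrite measure0 mule_ge0 // lee_fin risk_ge0.
  rewrite -subset0 => w [[_ ws] [t [st [alt _]]]].
  by move: dead; rewrite -ws (alive_earlier st alt).
elim: j s => [|j IH] s; have [al|/dead //] := boolP (alive k (gens N v s)).
  by rewrite risk0 // mul1e le_measure ?inE //; exact: measurableI.
pose C i := [set w : Defs.space X | (draw (size s) w).1 = i].
have mC i : measurable (C i).
  have -> : C i = (draw (e := X) (size s) : _ -> ('I_n * nat)%type) @^-1` [set x | x.1 = i].
    by [].
  exact: measurable_preimage_countable (measurable_draw X (size s)).
(* r i bounds the conditional probability of a collision if node i is drawn. *)
pose r i : R := if i \in seen v s then 1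
  else risk R N D k j (serve N (gens N v s) i) (rcons (seen v s) i).
have r0 i : 0 <= r i by rewrite /r; case: ifP => _; rewrite ?risk_ge0.
have mHC i : measurable (cylinder s `&` H s `&` C i).
  by apply: measurableI => //; exact: measurableI.
apply: (@le_trans _ _ (\sum_i P (cylinder s `&` H s `&` C i))%E).
  apply: measure_finU => // [|w ws]; first exact: measurableI.
  by exists (draw (size s) w).1.
apply: (@le_trans _ _ (\sum_i (size_bias R D i * r i)%:E * P (cylinder s))%E); last first.
  rewrite -ge0_sume_distrl => [|i _]; last by rewrite lee_fin mulr_ge0 ?size_bias_ge0.
  by rewrite sumEFin lee_wpmul2r // lee_fin collision_risk_step.
apply: lee_sum => i _; rewrite mulrC EFinM -muleA.
apply: (@le_trans _ _ ((r i)%:E * P (cylinder s `&` C i))%E); last first.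
  by rewrite lee_wpmul2l ?lee_fin // measure_next_node.
have mCC : measurable (cylinder s `&` C i) by exact: measurableI.
rewrite /r; case: ifP => iV.
  by rewrite mul1e le_measure ?inE // => w [[cw _] Cw].
apply: (@le_measure_fibers _ _ R P ('I_n * nat)%type (draw (size s)) _ _ _ _
    (measurable_draw X (size s)) (mHC i) mCC); first exact: risk_ge0.
move=> x; have [xi|xi] := eqVneq x.1 i; last first.
  apply: (@le_trans _ _ 0%E); last by rewrite mule_ge0 // lee_fin risk_ge0.
  rewrite le_eqVlt; apply/predU1P; left; apply: etrans (congr1 P _) (measure0 P).
  rewrite -subset0 => w [[_ wi] wx]; move/eqP: xi; apply.
  by rewrite -wi -wx.
have -> : (cylinder s `&` C i `&` draw (size s) @^-1` [set x]) = cylinder (rcons s x).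
  rewrite cylinder_rcons; apply/seteqP; split => [w [[? _] ?] //|w [cw wx]].
  by split => //; split => //; rewrite /C /= wx.
have := IH (rcons s x); rewrite gens_rcons /seen map_rcons -rcons_cons -/(seen v s) xi.
apply: le_trans; rewrite le_measure ?inE //.
- by apply: measurableI => //; exact: measurable_draw.
- exact: measurableI.
move=> w [[[cw [t [st [alt nt]]]] wi] wx]; split; first by rewrite cylinder_rcons.
exists t; split => //; rewrite size_rcons ltn_neqAle st andbT; apply/eqP => tE.
move: nt; rewrite -tE wi; case: cw => _ sE.
by rewrite /prefix_draws sE iV.
Qed.

End FixedRoot.

Lemma measure_tau_le_fixed_degrees j :
  (P ([set w | (tau X w <= k%:R%:E)%E] `&` E)
   <= (\sum_v n%:R^-1 * risk R N D k j (nseq (N v) 0%N) [:: v])%:E * P E)%E.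
Proof.
have mW v : measurable (E `&` (root_node (e := X)) @^-1` [set v]).
  by apply: measurableI => //; exact: measurable_root.
pose H v := hit_after (X := X) N k v 0.
have mH v : measurable (H v) by exact: measurable_hit_after.
apply: (@le_trans _ _ (\sum_v P (E `&` (root_node (e := X)) @^-1` [set v] `&` H v))%E).
  apply: measure_finU => [|v|w [/tau_le_first_bad[t [h [fb [hk _]]]] Ew]].
  - by apply: measurableI => //; exact: measurable_tau_le.
  - exact: measurableI.
  - exists (root_node w); split => //; exists t; split => //.
    have -> : N = (fun i => indeg i w) by apply/funext => i; rewrite indeg_E.
    exact: first_bad_hit fb hk.
rewrite -sumEFin ge0_sume_distrl => [|v _]; last by rewrite lee_fin mulr_ge0 ?risk_ge0.
apply: lee_sum => v _.
have := measure_hit_cylinder v j [::].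
have -> : draws_are (draw (e := X)) [::] = setT by apply/seteqP; split.
by rewrite setIT root_law // muleA -EFinM [_ * n%:R^-1]mulrC.
Qed.

End FixedDegrees.

(** * Events of the degree sequence *)

Section SigmaSeq.
Variables (R : realType) (n : nat) (X : exploration R n) (a : constants R).

Let generators : set (set (Defs.space X)) := [set A | exists i : 'I_n,
  (exists m : nat, A = indeg i @^-1` [set m] \/ A = outdeg i @^-1` [set m]) \/
  (exists B : set R, measurable B /\ (A = weight i @^-1` B \/ A = pers i @^-1` B))].
(** A measurable type for the sigma-algebra of the degree sequence, so that the
    closure properties of measurable functions apply to it. *)
Let T := g_sigma_algebraType generators.

Let measurable_indeg_nat (i : 'I_n) (B : set nat) : measurable (indeg i @^-1` B : set T).
Proof.
apply: (@measurable_preimage_countable _ T nat) => m.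
by apply: sub_sigma_algebra; exists i; left; exists m; left.
Qed.

Let measurable_outdeg_nat (i : 'I_n) (B : set nat) : measurable (outdeg i @^-1` B : set T).
Proof.
apply: (@measurable_preimage_countable _ T nat) => m.
by apply: sub_sigma_algebra; exists i; left; exists m; right.
Qed.

Let measurable_fun_indeg (i : 'I_n) (F : nat -> R) :
  measurable_fun setT (fun w : T => F (indeg i w)).
Proof. by move=> _ B _; rewrite setTI; exact: (measurable_indeg_nat i (F @^-1` B)). Qed.

Let measurable_fun_outdeg (i : 'I_n) (F : nat -> R) :
  measurable_fun setT (fun w : T => F (outdeg i w)).
Proof. by move=> _ B _; rewrite setTI; exact: (measurable_outdeg_nat i (F @^-1` B)). Qed.

Let measurable_fun_weight (i : 'I_n) : measurable_fun setT (weight i : T -> R).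
Proof.
move=> _ B mB; rewrite setTI; apply: sub_sigma_algebra.
by exists i; right; exists B; split => //; left.
Qed.

Let measurable_fun_pers (i : 'I_n) : measurable_fun setT (pers i : T -> R).
Proof.
move=> _ B mB; rewrite setTI; apply: sub_sigma_algebra.
by exists i; right; exists B; split => //; right.
Qed.

Let measurable_le_cst (f : T -> R) (c : R) : measurable_fun setT f ->
  measurable [set w | f w <= c].
Proof.
move=> mf; rewrite (_ : [set _ | _] = f @^-1` `]-oo, c]); last first.
  by apply/seteqP; split => w; rewrite /= in_itv.
by rewrite -[_ @^-1` _]setTI; exact: mf.
Qed.

Let measurable_close (f : T -> R) (x c : R) : measurable_fun setT f ->
  measurable [set w | `|f w - x| <= c].
Proof.
move=> mf; apply: measurable_le_cst; apply: measurableT_comp => //.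
exact: measurable_funB.
Qed.

(** The laws of root and draws are given on events of the degree sequence only,
    so measurability of Omega in the ambient space would not do. *)
Lemma sigma_seq_Omega : sigma_degrees X (Omega a X).
Proof.
suff : measurable (Omega a X : set T) by [].
have mCD (i : 'I_n) : measurable_fun setT
    (fun w : T => `|weight i w| * (outdeg i w)%:R).
  apply: measurable_funM; first exact: measurableT_comp.
  exact: (measurable_fun_outdeg i (fun m => m%:R)).
apply: measurableI; last first.
  apply: measurable_le_cst; apply: measurable_sum => i.
  exact: measurableT_comp.
apply: measurableI; last first.
  apply: measurableI; first by apply: measurable_close; exact: measurable_sum.
  rewrite (_ : [set w | _] = [set w | 0 <= cc a] `&`
      \bigcap_(i in setT) [set w : T | `|weight i w| * (outdeg i w)%:R <= cc a]).
    apply: measurableI.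
      case: (0 <= cc a).
        by rewrite (_ : [set _ | _] = setT) //; apply/seteqP; split.
      by rewrite (_ : [set _ | _] = set0) //; apply/seteqP; split.
    by apply: fin_bigcap_measurable => // i _; exact: measurable_le_cst.
  apply/seteqP; split => [w /bigmax_leP[c0 le]|w [c0 le]]; first by split => // i _; exact: le.
  by apply/bigmax_leP; split => // i _; exact: le.
apply: measurableI; last first.
  apply: measurable_close; apply: measurable_sum => i.
  exact: (measurable_fun_outdeg i (fun m => m%:R `^ (2 + kappa a))).
apply: measurableI; last first.
  apply: measurable_close; apply: measurable_sum => i.
  exact: (measurable_fun_outdeg i (fun m => m%:R ^+ 2)).
apply: measurableI; last first.
  apply: measurable_close; apply: measurable_sum => i; apply: measurable_funM.
    exact: (measurable_fun_outdeg i (fun m => m%:R)).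
  exact: (measurable_fun_indeg i (fun m => m%:R)).
apply: measurable_close; apply: measurable_sum => i.
exact: (measurable_fun_outdeg i (fun m => m%:R)).
Qed.

Lemma sigma_seq_degrees (N D : 'I_n -> nat) : sigma_degrees X
  [set w | (forall i, indeg i w = N i) /\ (forall i, outdeg i w = D i)].
Proof.
rewrite (_ : [set w | _] = \bigcap_(i in setT)
  (indeg i @^-1` [set N i] `&` outdeg i @^-1` [set D i])); last first.
  apply/seteqP; split => [w [Nw Dw] i _|w Nw]; first by split => /=.
  by split => i; have [] := Nw i I.
apply: (@fin_bigcap_measurable _ T) => // i _.
by apply: measurableI; [exact: measurable_indeg_nat|exact: measurable_outdeg_nat].
Qed.

Lemma sigma_seqI A B :
  sigma_degrees X A -> sigma_degrees X B -> sigma_degrees X (A `&` B).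
Proof. exact: (@measurableI _ T). Qed.

End SigmaSeq.

(** Omega splits into countably many events on which the degrees are constant,
    and a common bound on each of them passes to the union. *)
Lemma measure_tau_le (R : realType) n (X : exploration R n) (a : constants R) j k (c : R) :
  0 <= c ->
  (forall w, Omega a X w -> (0 < stubs (fun i => outdeg i w))%N /\
    \sum_v n%:R^-1 * risk R (fun i => indeg i w) (fun i => outdeg i w) k j
      (nseq (indeg v w) 0%N) [:: v] <= c) ->
  cond_prob (prob X) [set w | (tau X w <= k%:R%:E)%E] (Omega a X) <= c.
Proof.
move=> c0 bound; set P := prob X; set A := [set w | _]; set O := Omega a X.
have sO : sigma_degrees X O := @sigma_seq_Omega R n X a.
have mO : measurable O by exact: sub_sigma_seq_measurable sO.
have mA : measurable A by exact: measurable_tau_le.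
suff le : (P (A `&` O) <= c%:E * P O)%E.
  rewrite /cond_prob; have [P0|P0] := eqVneq (fine (P O)) 0; first by rewrite P0 invr0 mulr0.
  rewrite ler_pdivrMr; last by rewrite lt_neqAle eq_sym P0 fine_ge0.
  by rewrite -lee_fin EFinM !fineK ?fin_num_measure //; exact: measurableI.
pose f (w : Defs.space X) : {ffun 'I_n -> nat} * {ffun 'I_n -> nat} :=
  ([ffun i => indeg i w], [ffun i => outdeg i w]).
have fE w : f @^-1` [set f w] = [set w' | (forall i, indeg i w' = indeg i w) /\
    (forall i, outdeg i w' = outdeg i w)].
  apply/seteqP; split => w'.
    by move=> [/ffunP Nw /ffunP Dw]; split => i; [have := Nw i|have := Dw i]; rewrite !ffunE.
  by move=> [Nw Dw]; congr pair; apply/ffunP => i; rewrite !ffunE.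
apply: (@le_measure_fibers _ _ R P _ f) => //; last 1 first.
- move=> x; have [[w [Ow wx]]|no] := pselect (exists w, O w /\ f w = x); last first.
    apply: (@le_trans _ _ 0%E); last by rewrite mule_ge0.
    rewrite le_eqVlt; apply/predU1P; left; apply: etrans (congr1 P _) (measure0 P).
    by rewrite -subset0 => w [[_ Ow] wx]; apply: no; exists w.
  have [s0 le] := bound w Ow; rewrite -wx fE -setIA.
  set F := O `&` _.
  have sF : sigma_degrees X F := sigma_seqI sO (@sigma_seq_degrees R n X _ _).
  apply: le_trans (@measure_tau_le_fixed_degrees R n X (fun i => indeg i w)
    (fun i => outdeg i w) F k sF _ _ s0 j) _.
  + by move=> w' [_ []].
  + by move=> w' [_ []].
  + by rewrite lee_wpmul2r // lee_fin.
- move=> x; have [[w wx]|no] := pselect (exists w, f w = x).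
    by rewrite -wx fE; apply: sub_sigma_seq_measurable (@sigma_seq_degrees R n X _ _).
  suff -> : f @^-1` [set x] = set0 by [].
  by rewrite -subset0 => w wx; apply: no; exists w.
- exact: measurableI.
Qed.

(** * Degree sums on Omega *)

Lemma mean_degreesE (R : realType) n (N D : 'I_n -> nat) :
  mean_indeg R N D = (\sum_i (D i)%:R * (N i)%:R) / (stubs D)%:R /\
  mean_outdeg R D = (\sum_i (D i)%:R ^+ 2) / (stubs D)%:R.
Proof.
split; rewrite mulr_suml; apply: eq_bigr => i _; rewrite /size_bias mulrAC //.
Qed.

Lemma powR_half_div_sqr (R : realType) (x y : R) : 0 <= x -> 0 < y ->
  (x / y ^+ 2) `^ (- (1 / 2)) = x `^ (- (1 / 2)) * y.
Proof.
move=> x0 y0; rewrite !powRN mul1r !powR12_sqrt ?divr_ge0 ?sqr_ge0 //.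
by rewrite sqrtrM // sqrtrV ?sqr_ge0 // sqrtr_sqr gtr0_norm // invfM invrK.
Qed.

Lemma powR_half_sqrt (R : realType) (x : R) : 0 <= x ->
  x `^ (- (1 / 2)) = (Num.sqrt x)^-1.
Proof. by move=> x0; rewrite powRN mul1r powR12_sqrt. Qed.

(** With n d playing the role of n^(1 - gamma). The exponential form is chosen so
    that the k-th power of the mean in-degree costs a factor exp (c k d). *)
Lemma mean_indeg_close (R : realType) (s1 s2 n nu1 nu2 d : R) :
  0 < n -> 0 < nu1 -> 0 < nu2 -> 0 <= d -> d <= nu1 / 2 ->
  n * (nu1 - d) <= s1 -> s2 <= n * (nu2 + d) ->
  s2 / s1 <= nu2 / nu1 * expR (2 * (nu1 + nu2) / (nu1 * nu2) * d).
Proof.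
move=> n0 n10 n20 d0 d1 h1 h2.
have s0 : 0 < s1 by apply: lt_le_trans h1; rewrite mulr_gt0 //; lra.
apply: (@le_trans _ _ (nu2 / nu1 * (1 + 2 * (nu1 + nu2) / (nu1 * nu2) * d))); last first.
  by rewrite ler_wpM2l ?expR_ge1Dx // divr_ge0 // ltW.
rewrite ler_pdivrMr //.
have -> : nu2 / nu1 * (1 + 2 * (nu1 + nu2) / (nu1 * nu2) * d) =
  (nu2 + 2 * (1 + nu2 / nu1) * d) / nu1 by field; rewrite !gt_eqF.
have [q q0 qE] : exists2 q, 0 <= q & nu2 = q * nu1.
  by exists (nu2 / nu1); rewrite ?divr_ge0 ?(ltW _) // mulfVK // gt_eqF.
rewrite qE in h2 *; rewrite mulfK ?gt_eqF //.
apply: (le_trans h2).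
apply: (@le_trans _ _ ((q * nu1 + 2 * (1 + q) * d) / nu1 * (n * (nu1 - d)))); last first.
  by rewrite ler_wpM2l // divr_ge0 ?(ltW n10) // addr_ge0 ?mulr_ge0 ?(ltW n10) // addr_ge0.
rewrite [leRHS]mulrCA ler_wpM2l ?(ltW n0) // mulrAC ler_pdivlMr // -subr_ge0.
have -> : (q * nu1 + 2 * (1 + q) * d) * (nu1 - d) - (q * nu1 + d) * nu1 =
  d * (1 + q) * (nu1 - 2 * d) by ring.
by apply: mulr_ge0; [apply: mulr_ge0 => //; lra|lra].
Qed.

(** The right-hand side of mean_risk_root with r = sqrt n and j its floor: then
    both 1 / (j + 1) and j / n are at most 1 / r, while s1 / n and s3 / s1 are
    bounded. *)
Lemma risk_close (R : realType) (n s1 s3 nu1 nu3 d p r j : R) :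
  0 < nu1 -> 0 < nu3 -> 0 <= d -> d <= nu1 / 2 -> d <= 1 -> 0 < r -> n = r ^+ 2 ->
  n * (nu1 - d) <= s1 -> s1 <= n * (nu1 + d) -> 0 <= s3 -> s3 <= n * (nu3 + d) ->
  1 <= p -> 0 <= j -> j <= r -> r <= j + 1 ->
  s1 / n * p * ((j + 1)^-1 + j * (s3 / s1 / s1)) + j / n <=
  (nu1 + 2 + 2 * (nu3 + 1) / nu1) * p * r^-1.
Proof.
move=> n10 n30 d0 d1 d2 r0 nE h1 h2 s30 h3 p1 j0 jr rj.
have n0 : 0 < n by rewrite nE exprn_gt0.
have s0 : 0 < s1 by apply: lt_le_trans h1; rewrite mulr_gt0 //; lra.
have -> : s1 / n * p * ((j + 1)^-1 + j * (s3 / s1 / s1)) + j / n =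
  (s1 / n) * p * (j + 1)^-1 + (j / n) * (s3 / s1) * p + j / n.
  by field; rewrite !gt_eqF //; lra.
have a1 : s1 / n <= nu1 + 1.
  by rewrite ler_pdivrMr // mulrC (le_trans h2) // ler_wpM2l ?(ltW n0) //; lra.
have a10 : 0 <= s1 / n by rewrite divr_ge0 // ltW.
have a2 : (j + 1)^-1 <= r^-1 by rewrite lef_pV2 // posrE; lra.
have a3 : j / n <= r^-1.
  rewrite nE expr2 invfM mulrA ler_piMl ?invr_ge0 ?(ltW r0) //.
  by rewrite ler_pdivrMr // mul1r.
have a30 : 0 <= j / n by rewrite divr_ge0 // ltW.
have a4 : s3 / s1 <= 2 * (nu3 + 1) / nu1.
  rewrite ler_pdivrMr // mulrAC ler_pdivlMr //.
  apply: (@le_trans _ _ (n * (nu3 + 1) * nu1)).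
    rewrite ler_wpM2r ?(ltW n10) // (le_trans h3) // ler_wpM2l ?(ltW n0) //; lra.
  have -> : n * (nu3 + 1) * nu1 = 2 * (nu3 + 1) * (n * (nu1 / 2)) by field.
  rewrite ler_wpM2l //; first lra.
  by apply: le_trans h1; rewrite ler_wpM2l ?(ltW n0) //; lra.
have a40 : 0 <= s3 / s1 by rewrite divr_ge0 // ltW.
have ri : 0 < r^-1 by rewrite invr_gt0.
have -> : (nu1 + 2 + 2 * (nu3 + 1) / nu1) * p * r^-1 =
  (nu1 + 1) * p * r^-1 + r^-1 * (2 * (nu3 + 1) / nu1) * p + p * r^-1 by ring.
have p0 : 0 <= p by lra.
have j1 : 0 <= (j + 1)^-1 by rewrite invr_ge0; lra.
apply: lerD; first apply: lerD.
- by apply: ler_pM => //; [exact: mulr_ge0|exact: ler_wpM2r].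
- by apply: ler_wpM2r => //; exact: ler_pM.
- by apply: (le_trans a3); rewrite ler_peMl // ltW.
Qed.

Lemma progeny_le (R : realType) n (N D : 'I_n -> nat) (q e : R) k :
  mean_indeg R N D <= q * expR e -> 0 <= e -> 0 <= q ->
  progeny R N D k <= expR (k%:R * e) * \sum_(i < k.+1) q ^+ i.
Proof.
move=> le e0 q0; rewrite /progeny mulr_sumr; apply: ler_sum => i _.
apply: (@le_trans _ _ ((q * expR e) ^+ i)).
  by rewrite lerXn2r ?nnegrE ?mean_indeg_ge0 // mulr_ge0 ?expR_ge0.
rewrite exprMn mulrC ler_wpM2r ?exprn_ge0 // -expRM_natl ler_expR.
by rewrite ler_wpM2r // ler_nat -ltnS.
Qed.

Section Assembly.
Variables (R : realType) (a : constants R).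
Hypothesis valid : valid_constants a.

(** The constant c of mean_indeg_close. *)
Definition growth_rate : R := 2 * (nu1 a + nu2 a) / (nu1 a * nu2 a).
(** The constant of risk_close. *)
Definition prefactor : R := nu1 a + 2 + 2 * (nu3 a + 1) / nu1 a.

(** The common estimate behind the three regimes, which differ only in the size
    of the geometric sum. *)
Lemma cond_prob_tau_le n (X : exploration R n) k : (0 < n)%N ->
  n%:R `^ (- gamma a) <= Num.min (nu1 a / 2) 1 ->
  cond_prob (prob X) [set w | (tau X w <= k%:R%:E)%E] (Omega a X) <=
  prefactor * (expR (k%:R * (growth_rate * n%:R `^ (- gamma a)))
    * \sum_(i < k.+1) mu a ^+ i) * n%:R `^ (- (1 / 2)).
Proof.
move=> n0; rewrite le_min => /andP[d1 d2].
case: valid => _ [n1 n2 n3 _ _] _ _ [_ _ _].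
set d := n%:R `^ (- gamma a) in d1 d2 *.
have d0 : 0 <= d by exact: powR_ge0.
have nR0 : 0 < n%:R :> R by rewrite ltr0n.
have nd : n%:R `^ (1 - gamma a) = n%:R * d.
  rewrite powRD; last by apply/implyP => _; rewrite gt_eqF.
  by rewrite powRr1 // ltW.
have g0 : 0 <= growth_rate by rewrite /growth_rate divr_ge0 ?mulr_ge0 // ?addr_ge0 // ltW.
have mu0 : 0 <= mu a by rewrite /mu divr_ge0 // ltW.
set r := Num.sqrt (n%:R : R).
have r0 : 0 < r by rewrite sqrtr_gt0.
have nE : n%:R = r ^+ 2 by rewrite sqr_sqrtr // ltW.
have /andP[j1 j2] := truncn_itv (ltW r0).
set j := Num.truncn r in j1 j2.
have C0 : 0 <= prefactor by rewrite /prefactor !addr_ge0 ?divr_ge0 ?mulr_ge0 ?addr_ge0 // ltW.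
have B0 : 0 <= prefactor * (expR (k%:R * (growth_rate * d)) * \sum_(i < k.+1) mu a ^+ i)
    * n%:R `^ (- (1 / 2)).
  rewrite mulr_ge0 ?powR_ge0 // mulr_ge0 // mulr_ge0 ?expR_ge0 //.
  by apply: sumr_ge0 => i _; rewrite exprn_ge0.
apply: (@measure_tau_le R n X a j k) => // w [] [] [] [] [] O1 O2 O3 _ _ _.
pose N i := indeg (e := X) i w; pose D i := outdeg (e := X) i w.
have s1E : \sum_r (outdeg r w)%:R = (stubs D)%:R :> R by rewrite natr_sum.
move: O1 O2 O3; rewrite /Omega1 /Omega2 /Omega3 /= nd s1E !ler_distl.
move=> /andP[s1l s1u] /andP[_ s2u] /andP[_ s3u].
rewrite -mulrBr in s1l; rewrite -!mulrDr in s1u s2u s3u.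
(* L is at least n nu1 / 2, by the smallness assumed of n^(-gamma). *)
have s1 : 0 < (stubs D)%:R :> R by apply: lt_le_trans s1l; rewrite mulr_gt0 //; lra.
have stubs_gt0 : (0 < stubs D)%N by rewrite ltr0n in s1.
split; first exact: stubs_gt0.
rewrite -/N -/D.
have [miE moE] := mean_degreesE R N D.
have NE : \sum_i (N i)%:R = (stubs D)%:R :> R.
  by rewrite -natr_sum; congr _%:R; exact: sum_indeg.
have mi : mean_indeg R N D <= mu a * expR (growth_rate * d).
  by rewrite miE; exact: mean_indeg_close d0 d1 s1l s2u.
apply: (le_trans (mean_risk_root R N k stubs_gt0 j n0)).
rewrite NE moE -natr1.
apply: (@le_trans _ _ (prefactor * progeny R N D k * r^-1)).
  apply: (risk_close (nu3 := nu3 a) (d := d)) => //.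
  - by apply: sumr_ge0 => i _; exact: sqr_ge0.
  - exact: progeny_ge1.
  - by rewrite natr1 ltW.
rewrite powR_half_sqrt ?(ltW nR0) // -/r ler_wpM2r ?invr_ge0 ?(ltW r0) //.
rewrite ler_wpM2l //; apply: progeny_le => //; exact: mulr_ge0.
Qed.

Lemma near_powRN_le (g e : R) : 0 < g -> 0 < e ->
  \forall m \near \oo, m.+1%:R `^ (- g) <= e.
Proof.
move=> g0 e0; near=> m.
have : e `^ (- g^-1) <= m.+1%:R.
  apply: (@le_trans _ _ m%:R); last by rewrite ler_nat.
  near: m; exact: nbhs_infty_ger.
move=> /(@ge0_ler_powR _ _ (ltW g0)) le.
rewrite powRN -[e]invrK lef_pV2 ?posrE ?invr_gt0 ?powR_gt0 //.
rewrite -[e^-1]powR_inv1 ?(ltW e0) //.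
rewrite (_ : -1 = - g^-1 * g); last by rewrite mulNr mulVf // gt_eqF.
by rewrite powRrM; apply: le; rewrite nnegrE ?powR_ge0.
Unshelve. all: by end_near.
Qed.

End Assembly.

(* X m is the exploration on n = m.+1 nodes; the bounds are uniform over the
   admissible generations k, which may therefore depend on n. *)
Theorem lemma5p4 (R : realType) (a : constants R)
    (X : forall m, exploration R m.+1) (hA : assumptionA a X) :
  let p (m k : nat) : R :=
    cond_prob (prob (X m)) [set w | (tau (X m) w <= k%:R%:E)%E] (Omega a (X m)) in
  (1 < mu a -> forall h : R, 0 < h < 1 / (2 * ln (mu a)) ->
    exists K : R, \forall m \near \oo, forall k : nat,
      (1 <= k)%N -> k%:R <= h * ln m.+1%:R ->
      p m k <= K * (m.+1%:R / mu a ^+ (2 * k)) `^ (- (1 / 2))) /\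
  (mu a <= 1 -> forall b : R, 0 < b < Num.min (1 / 2) (gamma a) ->
    exists K : R, \forall m \near \oo, forall k : nat,
      (1 <= k)%N -> k%:R <= m.+1%:R `^ b ->
      (mu a = 1 -> p m k <= K * (m.+1%:R / k%:R ^+ 2) `^ (- (1 / 2))) /\
      (mu a < 1 -> p m k <= K * m.+1%:R `^ (- (1 / 2)))).
Proof.
move=> p; have [valid _] := hA.
have [_ [n1 n2 n3 _ _] _ _ [_ /andP[g0 _] _]] := valid.
have d0 : 0 < Num.min (nu1 a / 2) 1 by rewrite lt_min ltr01 andbT divr_gt0.
have near_small := near_powRN_le g0 d0.
have C0 : 0 <= prefactor a by rewrite /prefactor !addr_ge0 ?divr_ge0 ?mulr_ge0 ?addr_ge0 // ltW.
have c0 : 0 <= growth_rate a by rewrite /growth_rate divr_ge0 ?mulr_ge0 // ?addr_ge0 // ltW.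
have mu0 : 0 < mu a by rewrite /mu divr_gt0.
have bound m k t s : m.+1%:R `^ (- gamma a) <= Num.min (nu1 a / 2) 1 ->
    k%:R * m.+1%:R `^ (- gamma a) <= t -> \sum_(i < k.+1) mu a ^+ i <= s ->
    p m k <= prefactor a * expR (growth_rate a * t) * s * m.+1%:R `^ (- (1 / 2)).
  move=> small kt ms; apply: (le_trans (cond_prob_tau_le valid (X m) k _ small)) => //.
  rewrite ler_wpM2r ?powR_ge0 // -mulrA ler_wpM2l // ler_pM ?expR_ge0 //.
    by apply: sumr_ge0 => i _; rewrite exprn_ge0 // ltW.
  by rewrite ler_expR mulrCA ler_wpM2l.
split => [mu1 h /andP[h0 _]|mu1 b /andP[b0]].
  exists (prefactor a * expR (growth_rate a * (h / gamma a)) * (mu a / (mu a - 1))).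
  near=> m => k k1 kh.
  have small : m.+1%:R `^ (- gamma a) <= Num.min (nu1 a / 2) 1 by near: m.
  rewrite mulnC exprM powR_half_div_sqr ?exprn_gt0 //.
  rewrite [m.+1%:R `^ _ * _]mulrC [_ * (mu a ^+ k * _)]mulrA.
  rewrite -[_ * (mu a / _) * _]mulrA; apply: bound => //.
    (* k n^(-gamma) <= h / gamma, because gamma ln n = ln (n^gamma) <= n^gamma. *)
    rewrite powRN ler_pdivrMr ?powR_gt0 // (le_trans kh) // -mulrA ler_wpM2l ?(ltW h0) //.
    rewrite mulrC ler_pdivlMr // mulrC -ln_powR ltW // ln_sublinear // powR_gt0 //.
  (* (mu - 1) (1 + ... + mu^k) = mu^(k + 1) - 1. *)
  have mu1' : 0 < mu a - 1 by rewrite subr_gt0.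
  rewrite mulrAC ler_pdivlMr // mulrC -subrX1 -exprS gerBl ler01 //.
rewrite lt_min => /andP[_ bg].
(* k n^(-gamma) <= 1 as b < gamma. One constant serves both regimes: the
   geometric sum is k + 1 <= 2 k if mu = 1, where (1 - mu)^-1 is 0^-1 = 0, and
   at most (1 - mu)^-1 if mu < 1. *)
exists (prefactor a * expR (growth_rate a * 1) * (2 + (1 - mu a)^-1)).
near=> m => k k1 kb.
have small : m.+1%:R `^ (- gamma a) <= Num.min (nu1 a / 2) 1 by near: m.
have kd : k%:R * m.+1%:R `^ (- gamma a) <= 1.
  rewrite powRN ler_pdivrMr ?powR_gt0 // mul1r (le_trans kb) // ler_powR ?ler1n //.
  exact: ltW.
split => [muE|mu1'].
  rewrite powR_half_div_sqr ?ltr0n //.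
  rewrite [m.+1%:R `^ _ * _]mulrC [_ * (k%:R * _)]mulrA.
  rewrite -[_ * (2 + _) * _]mulrA; apply: bound => //.
  rewrite muE subrr invr0 addr0; under eq_bigr do rewrite expr1n.
  by rewrite sumr_const card_ord -natrM ler_nat mul2n -addnn -addn1 leq_add2l.
apply: bound => //; apply: (@le_trans _ _ (1 - mu a)^-1); last by rewrite lerDr.
rewrite -[leRHS]mul1r ler_pdivlMr ?subr_gt0 // mulrC.
by rewrite -opprB mulNr -subrX1 opprB gerBl exprn_ge0 // ltW.
Unshelve. all: by end_near.
Qed.
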